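(* Let $a,b,\lambda,q\in\mathbb{C}$ with $0<|q|<1$. Suppose that $a,b,\lambda$ do not vanish simultaneously and that $\lambda\neq abq^n$, $\lambda\neq -b/q^n$ and $\lambda\neq -a/q^{n-1}$ for all $n=1,2,3,\dots$. Consider the continued fractions $$F_1 = 1+\cfrac{aq+\lambda q}{1+\cfrac{bq+\lambda q^2}{1+\cfrac{aq^2+\lambda q^3}{1+\cfrac{bq^2+\lambda q^4}{1+\cdots}}}},$$ that is, $F_1=1+K_{k\ge1}(a_k/1)$ with $a_{2n-1}=aq^n+\lambda q^{2n-1}$ and $a_{2n}=bq^n+\lambda q^{2n}$ for $n\ge 1$; $$F_2 = 1+aq+K_{n\ge 1}\left(\frac{\lambda q^n-abq^{2n}}{1+bq^n+aq^{n+1}}\right);$$ $$F_3 = 1-b+aq+K_{n\ge1}\left(\frac{\lambda q^n+b}{1-b+aq^{n+1}}\right);$$ $$F_4 = 1+K_{n\ge1}\left(\frac{aq+\lambda q^n}{1-aq+bq^n}\right).$$ Then $F_1=F_2$; if moreover $|b|<1$, then also $F_3$ equals $F_1=F_2$; and if moreover $|aq|<1$, then also $F_4$ equals $F_1=F_2$.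
   Context: For complex sequences $(a_n)_{n\ge1}$ with all $a_n\neq 0$ and $(b_n)_{n\ge0}$, the continued fraction $b_0+K_{n\ge1}(a_n/b_n)$ is $$b_0+\cfrac{a_1}{b_1+\cfrac{a_2}{b_2+\cfrac{a_3}{b_3+\cdots}}}.$$ It converges to a value $f\in\hat{\mathbb{C}}=\mathbb{C}\cup\{\infty\}$ if its sequence of approximants $f_n=b_0+\cfrac{a_1}{b_1+\cdots+\cfrac{a_n}{b_n}}$ converges to $f$ in $\hat{\mathbb{C}}$ as $n\to\infty$. An equality of continued fractions means that they converge to the same value in $\hat{\mathbb C}$. *)

(* Defs.v *)
From Stdlib Require Import Reals.
From Coquelicot Require Import Coquelicot.
Open Scope C_scope.

Inductive sphere : Type :=
  | Fin : C -> sphere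
  | Inf : sphere.

(** Neighbourhood filters of the one-point compactification of [C] (the Riemann sphere): the
    neighbourhoods of [Inf] contain the complement of some closed disc. *)
Definition sphere_locally (x : sphere) (P : sphere -> Prop) : Prop :=
  match x with
  | Fin z => locally z (fun w : C => P (Fin w))
  | Inf => P Inf /\ exists M : R, forall w : C, (M < Cmod w)%R -> P (Fin w)
  end.

Definition sphere_add (b : C) (x : sphere) : sphere :=
  match x with
  | Fin z => Fin (b + z)
  | Inf => Inf
  end.

(** [sphere_div a x] is a / x, meant for a <> 0: then a / 0 = Inf and
    a / Inf = 0. *)
Definition sphere_div (a : C) (x : sphere) : sphere :=
  match x with
  | Fin z => if Ceq_dec z 0 then Inf else Fin (a / z)
  | Inf => Fin 0
  end.

(** b0 + a 1 / (b 1 + a 2 / (b 2 + ... + a n / b n)).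
    The values [a 0] and [b 0] are never used; the term of index 0 is the
    separate argument [b0]. *)
Fixpoint approximant (b0 : C) (a b : nat -> C) (n : nat) : sphere :=
  match n with
  | O => Fin b0
  | S m =>
      sphere_add b0
        (sphere_div (a 1%nat)
           (approximant (b 1%nat) (fun k => a (S k)) (fun k => b (S k)) m))
  end.

Record contfrac : Type := ContFrac {
  cf_first : C;
  cf_num : nat -> C;
  cf_den : nat -> C
}.

(** Convergence in the sphere; the nonvanishing of the partial numerators is
    part of what it means for the expression to be a continued fraction. *)
Definition cf_converges (F : contfrac) (f : sphere) : Prop :=
  (forall n : nat, (1 <= n)%nat -> cf_num F n <> 0) /\
  filterlim (approximant (cf_first F) (cf_num F) (cf_den F))
    eventually (sphere_locally f).

(** Partial numerators a q^n + lam q^(2n-1) at index 2n-1 and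
    b q^n + lam q^(2n) at index 2n. *)
Definition F1 (a b lam q : C) : contfrac :=
  ContFrac 1
    (fun k => if Nat.even k
              then b * q ^ (k / 2) + lam * q ^ k
              else a * q ^ ((k + 1) / 2) + lam * q ^ k)
    (fun _ => 1).

Definition F2 (a b lam q : C) : contfrac :=
  ContFrac (1 + a * q)
    (fun n => lam * q ^ n - a * b * q ^ (2 * n))
    (fun n => 1 + b * q ^ n + a * q ^ (n + 1)).

Definition F3 (a b lam q : C) : contfrac :=
  ContFrac (1 - b + a * q)
    (fun n => lam * q ^ n + b)
    (fun n => 1 - b + a * q ^ (n + 1)).

Definition F4 (a b lam q : C) : contfrac :=
  ContFrac 1
    (fun n => a * q + lam * q ^ n)
    (fun n => 1 - a * q + b * q ^ n).

(* Main.v *)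
Require Import Defs.
From Stdlib Require Import Reals Lra Lia.
From Coquelicot Require Import Coquelicot.
Open Scope C_scope.

(** All four continued fractions come from one function [G(a,b,l)], the sum over
    [m, n, k >= 0] of
      a^m b^n l^k q^(m(m+1)/2 + n(n+1)/2 + k^2 + mn + mk + nk)
        / ((q;q)_m (q;q)_n (q;q)_k),
    which satisfies
      G(a,b,l) - G(aq,b,l) = aq G(aq,bq,lq),
      G(a,b,l) - G(a,bq,l) = bq G(aq,bq,lq),
      G(a,b,l) - G(a,b,lq) = lq G(aq,bq,lq^2).
    These imply the three-term recurrences
    [X n = den n * X (n+1) + num (n+1) * X (n+2)] of F1, ..., F4, along four
    different sequences of arguments which share
    [X 0 = G(a,b,l)] and [X 1 = G(aq,b,lq)].
    Each [X n] has a nonzero limit: 1 for F1 and F2, [G(0,b,0)] for F3 and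
    [G(aq,0,0)] for F4, and each [num n] has a limit of modulus below 1.
    Pairing consecutive convergents with such an [X] gives a first-order
    recurrence whose coefficients have limits, so numerators and denominators
    both converge, to a common nonzero multiple of [X 0] and [X 1]. *)

(** * Limits of complex sequences *)

Lemma Cinv_neq_0 (x : C) : x <> 0 -> / x <> 0.
Proof.
  intros Hx H; apply C1_nz; rewrite <- (Cinv_r x Hx), H; ring.
Qed.

(** Phrased through moduli so that the squeeze and product rules for real sequences apply;
    [Clim_filterlim] converts back to filters. *)
Definition Clim (u : nat -> C) (l : C) : Prop :=
  is_lim_seq (fun n => Cmod (u n - l)) 0%R.

Lemma Clim_squeeze (u : nat -> C) (l : C) (v : nat -> R) :
  (exists N, forall n, (N <= n)%nat -> (Cmod (u n - l) <= v n)%R) ->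
  is_lim_seq v 0%R -> Clim u l.
Proof.
  intros [N HN] Hv.
  apply (is_lim_seq_le_le_loc (fun _ => 0%R) _ v).
  - exists N; intros n Hn; split; [apply Cmod_ge_0 | now apply HN].
  - apply is_lim_seq_const.
  - exact Hv.
Qed.

Lemma Clim_S (u : nat -> C) (l : C) : Clim (fun n => u (S n)) l <-> Clim u l.
Proof.
  unfold Clim; rewrite (is_lim_seq_incr_1 (fun n => Cmod (u n - l))); tauto.
Qed.

Lemma Clim_mult (u v : nat -> C) (l m : C) :
  Clim u l -> Clim v m -> Clim (fun n => u n * v n) (l * m).
Proof.
  intros Hu Hv.
  apply (Clim_squeeze _ _ (fun n => Cmod (u n - l) * Cmod (v n - m)
           + (Cmod m * Cmod (u n - l) + Cmod l * Cmod (v n - m)))%R).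
  - exists 0%nat; intros n _.
    replace (u n * v n - l * m)
      with ((u n - l) * (v n - m) + (m * (u n - l) + l * (v n - m))) by ring.
    rewrite <- !Cmod_mult.
    eapply Rle_trans; [apply Cmod_triangle | apply Rplus_le_compat_l].
    apply Cmod_triangle.
  - replace (Finite 0) with (Finite (0 * 0 + (Cmod m * 0 + Cmod l * 0))%R)
      by (f_equal; ring).
    apply is_lim_seq_plus'; [now apply is_lim_seq_mult' |].
    apply is_lim_seq_plus'; apply is_lim_seq_mult'; auto; apply is_lim_seq_const.
Qed.

Lemma Clim_minus (u v : nat -> C) (l m : C) :
  Clim u l -> Clim v m -> Clim (fun n => u n - v n) (l - m).
Proof.
  intros Hu Hv.
  apply (Clim_squeeze _ _ (fun n => Cmod (u n - l) + Cmod (v n - m))%R).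
  - exists 0%nat; intros n _.
    replace (u n - v n - (l - m)) with ((u n - l) + - (v n - m)) by ring.
    rewrite <- (Cmod_opp (v n - m)); apply Cmod_triangle.
  - replace (Finite 0) with (Finite (0 + 0)%R) by (f_equal; ring).
    now apply is_lim_seq_plus'.
Qed.

Lemma Clim_const (c : C) : Clim (fun _ => c) c.
Proof.
  apply (Clim_squeeze _ _ (fun _ => 0%R)); [| apply is_lim_seq_const].
  exists 0%nat; intros n _; replace (c - c) with (RtoC 0) by ring.
  rewrite Cmod_0; lra.
Qed.

Lemma Clim_eventually (u : nat -> C) (l : C) (e : R) :
  Clim u l -> (0 < e)%R ->
  exists N, forall n, (N <= n)%nat -> (Cmod (u n - l) < e)%R.
Proof.
  intros Hu He.
  destruct (proj2 (is_lim_seq_spec _ _) Hu (mkposreal e He)) as [N HN].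
  exists N; intros n Hn; specialize (HN n Hn); simpl in HN.
  rewrite Rminus_0_r, Rabs_pos_eq in HN; [exact HN | apply Cmod_ge_0].
Qed.

Lemma Clim_away_from_0 (u : nat -> C) (l : C) :
  Clim u l -> l <> 0 ->
  exists N, forall n, (N <= n)%nat -> (Cmod l / 2 < Cmod (u n))%R.
Proof.
  intros Hu Hl.
  assert (Hl' : (0 < Cmod l)%R) by now apply Cmod_gt_0.
  destruct (Clim_eventually _ _ (Cmod l / 2) Hu) as [N HN]; [lra |].
  exists N; intros n Hn; specialize (HN n Hn).
  assert (H := Cmod_triangle (u n) (- (u n - l))).
  rewrite Cmod_opp in H; replace (u n + - (u n - l)) with l in H by ring; lra.
Qed.

Lemma Clim_inv (u : nat -> C) (l : C) :
  Clim u l -> l <> 0 -> Clim (fun n => / u n) (/ l).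
Proof.
  intros Hu Hl.
  assert (Hl' : (0 < Cmod l)%R) by now apply Cmod_gt_0.
  destruct (Clim_away_from_0 _ _ Hu Hl) as [N HN].
  apply (Clim_squeeze _ _ (fun n => 2 / (Cmod l * Cmod l) * Cmod (u n - l))%R).
  - exists N; intros n Hn; specialize (HN n Hn).
    assert (Hun : u n <> 0) by (apply Cmod_gt_0; lra).
    replace (/ u n - / l) with (- (u n - l) / (u n * l)) by (field; auto).
    rewrite Cmod_div by now apply Cmult_neq_0.
    rewrite Cmod_opp, Cmod_mult.
    apply Rle_trans with (/ (Cmod (u n) * Cmod l) * Cmod (u n - l))%R;
      [unfold Rdiv; lra |].
    apply Rmult_le_compat_r; [apply Cmod_ge_0 |].
    replace (2 / (Cmod l * Cmod l))%R with (/ (Cmod l / 2 * Cmod l))%R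
      by (field; lra).
    apply Rinv_le_contravar; [apply Rmult_lt_0_compat; lra |].
    apply Rmult_le_compat_r; lra.
  - replace (Finite 0) with (Finite (2 / (Cmod l * Cmod l) * 0)%R)
      by (f_equal; ring).
    apply is_lim_seq_mult'; [apply is_lim_seq_const | exact Hu].
Qed.

Lemma Clim_filterlim (u : nat -> C) (l : C) :
  Clim u l -> filterlim u eventually (locally l).
Proof.
  intros Hu; apply filterlim_locally; intros e.
  destruct (Clim_eventually _ _ e Hu (cond_pos e)) as [N HN].
  exists N; intros n Hn; apply C_NormedModule_mixin_compat1; now apply HN.
Qed.

Lemma contraction_lim_0 (r : R) (e u : nat -> R) (N : nat) :
  (0 <= r < 1)%R -> (forall n, (0 <= u n)%R) -> is_lim_seq e 0%R ->
  (forall n, (N <= n)%nat -> (u (S n) <= e n + r * u n)%R) ->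
  is_lim_seq u 0%R.
Proof.
  intros Hr Hu He Hrec.
  apply is_lim_seq_spec; intros [d Hd]; simpl.
  (* Once [e] stays below this bound, [d / 2] is the fixed point of the majorising recursion, so the
     excess of [u] over [d / 2] decays like [r ^ k]. *)
  assert (Hd' : (0 < d / 2 * (1 - r))%R) by (apply Rmult_lt_0_compat; lra).
  destruct (proj2 (is_lim_seq_spec _ _) He (mkposreal _ Hd')) as [N1 HN1].
  set (M := Nat.max N N1).
  assert (Hgeo : forall k, (u (k + M)%nat <= d / 2 + r ^ k * u M)%R).
  { induction k as [| k IH]; simpl; [lra |].
    assert (Hk : (N <= k + M)%nat) by lia.
    assert (Hk1 : (N1 <= k + M)%nat) by lia.
    specialize (Hrec _ Hk); specialize (HN1 _ Hk1); simpl in HN1.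
    apply Rabs_def2 in HN1.
    assert (r * u (k + M)%nat <= r * (d / 2 + r ^ k * u M))%R
      by (apply Rmult_le_compat_l; lra).
    nra. }
  assert (Hlim : is_lim_seq (fun k => u M * r ^ k)%R 0%R).
  { replace (Finite 0) with (Finite (u M * 0)%R) by (f_equal; ring).
    apply is_lim_seq_mult'; [apply is_lim_seq_const |].
    apply is_lim_seq_geom; rewrite Rabs_pos_eq; lra. }
  assert (Hd2 : (0 < d / 2)%R) by lra.
  destruct (proj2 (is_lim_seq_spec _ _) Hlim (mkposreal _ Hd2)) as [N2 HN2].
  exists (N2 + M)%nat; intros n Hn.
  assert (Hk2 : (N2 <= n - M)%nat) by lia.
  specialize (HN2 _ Hk2); simpl in HN2; apply Rabs_def2 in HN2.
  specialize (Hgeo (n - M)%nat); replace (n - M + M)%nat with n in Hgeo by lia.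
  rewrite Rminus_0_r, Rabs_pos_eq; [lra | apply Hu].
Qed.

(** The limit is the fixed point [t = l - g * t]. The distance from [u n] to [t] obeys a perturbed
    contraction whose error term tends to 0, so [contraction_lim_0] applies. *)
Lemma Clim_linear_recurrence (x c u : nat -> C) (l g : C) :
  Clim x l -> Clim c g -> (Cmod g < 1)%R ->
  (exists N, forall n, (N <= n)%nat -> u (S n) = x n - c n * u n) ->
  Clim u (l / (1 + g)).
Proof.
  intros Hx Hc Hg [N HN].
  assert (Hg1 : 1 + g <> 0).
  { intros H; replace g with (- (1)) in Hg by (rewrite <- (Cplus_0_r (- (1))), <- H; ring).
    rewrite Cmod_m1 in Hg; lra. }
  set (t := l / (1 + g)).
  (* With this tolerance [Cmod (c n)] is eventually below [(1 + Cmod g) / 2], the midpoint of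
     [Cmod g] and 1. *)
  destruct (Clim_eventually _ _ ((1 - Cmod g) / 2) Hc) as [N1 HN1]; [lra |].
  apply (contraction_lim_0 ((1 + Cmod g) / 2)
    (fun n => Cmod (x n - c n * t - (l - g * t))) _ (Nat.max N N1)).
  - assert (H := Cmod_ge_0 g); lra.
  - intros; apply Cmod_ge_0.
  - apply Clim_minus, Clim_mult; auto; apply Clim_const.
  - intros n Hn.
    rewrite HN by lia.
    replace (x n - c n * u n - t)
      with ((x n - c n * t - (l - g * t)) + - (c n * (u n - t)))
      by (unfold t; field; auto).
    eapply Rle_trans; [apply Cmod_triangle | apply Rplus_le_compat_l].
    rewrite Cmod_opp, Cmod_mult; apply Rmult_le_compat_r; [apply Cmod_ge_0 |].
    assert (H1 : (N1 <= n)%nat) by lia; specialize (HN1 _ H1).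
    assert (H := Cmod_triangle (c n - g) g).
    replace (c n - g + g) with (c n) in H by ring; lra.
Qed.

(** * Convergence of a continued fraction from a solution of its recurrence *)

(** The point of the sphere with homogeneous coordinates [x], [y]. The pair (0, 0) also gets [Inf],
    hence the nonvanishing conditions in the limit statements. *)
Definition ratio (x y : C) : sphere :=
  if Ceq_dec y 0 then Inf else Fin (x / y).

Lemma ratio_scale (c x y : C) : c <> 0 -> ratio (c * x) (c * y) = ratio x y.
Proof.
  intros Hc; unfold ratio.
  destruct (Ceq_dec y 0) as [-> | Hy].
  - destruct (Ceq_dec (c * 0) 0) as [| H]; [reflexivity |].
    now contradict H; ring.
  - destruct (Ceq_dec (c * y) 0) as [H |].
    + now contradict H; apply Cmult_neq_0.
    + f_equal; field; auto.
Qed.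

Lemma ratio_lim (u v : nat -> C) (x y : C) :
  Clim u x -> Clim v y -> x <> 0 \/ y <> 0 ->
  filterlim (fun n => ratio (u n) (v n)) eventually (sphere_locally (ratio x y)).
Proof.
  intros Hu Hv Hxy P HP; unfold filtermap.
  unfold ratio in HP at 1; destruct (Ceq_dec y 0) as [Hy | Hy].
  - destruct HP as [Pinf [M HM]].
    assert (Hx : x <> 0) by tauto.
    assert (Hx' : (0 < Cmod x)%R) by now apply Cmod_gt_0.
    subst y.
    destruct (Clim_away_from_0 _ _ Hu Hx) as [N1 HN1].
    (* [M] may be negative or zero; [Rabs M + 1] is a positive radius that dominates it. *)
    assert (HM' : (0 < Rabs M + 1)%R) by (assert (H := Rabs_pos M); lra).
    destruct (Clim_eventually _ _ (Cmod x / 2 / (Rabs M + 1))%R Hv) as [N2 HN2].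
    { apply Rdiv_lt_0_compat; lra. }
    exists (Nat.max N1 N2); intros n Hn.
    assert (H1 : (N1 <= n)%nat) by lia; assert (H2 : (N2 <= n)%nat) by lia.
    specialize (HN1 _ H1); specialize (HN2 _ H2).
    replace (v n - 0) with (v n) in HN2 by ring.
    unfold ratio; destruct (Ceq_dec (v n) 0) as [| Hvn]; [exact Pinf |].
    apply HM; rewrite Cmod_div by exact Hvn.
    assert (Hvn' : (0 < Cmod (v n))%R) by now apply Cmod_gt_0.
    apply Rle_lt_trans with (Rabs M + 1)%R; [assert (H := Rle_abs M); lra |].
    apply (Rmult_lt_reg_r (Cmod (v n))); [exact Hvn' |].
    replace (Cmod (u n) / Cmod (v n) * Cmod (v n))%R with (Cmod (u n))
      by (field; lra).
    apply (Rmult_lt_compat_l _ _ _ HM') in HN2.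
    replace ((Rabs M + 1) * (Cmod x / 2 / (Rabs M + 1)))%R with (Cmod x / 2)%R
      in HN2 by (field; lra).
    lra.
  - assert (Hq : Clim (fun n => u n / v n) (x / y))
      by (apply Clim_mult; [| apply Clim_inv]; auto).
    apply Clim_filterlim in Hq.
    destruct (Hq _ HP) as [N1 HN1].
    destruct (Clim_away_from_0 _ _ Hv Hy) as [N2 HN2].
    exists (Nat.max N1 N2); intros n Hn.
    assert (H1 : (N1 <= n)%nat) by lia; assert (H2 : (N2 <= n)%nat) by lia.
    specialize (HN1 _ H1); specialize (HN2 _ H2).
    unfold ratio; destruct (Ceq_dec (v n) 0) as [Hvn |]; [| exact HN1].
    rewrite Hvn, Cmod_0 in HN2; assert (H := Cmod_ge_0 y); lra.
Qed.

(** Numerator and denominator of the [n]-th approximant, computed from the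
    front so as to match the recursion of [approximant]. *)
Fixpoint convergent (b0 : C) (a b : nat -> C) (n : nat) : C * C :=
  match n with
  | O => (b0, RtoC 1)
  | S m =>
      let c := convergent (b 1%nat) (fun k => a (S k)) (fun k => b (S k)) m in
      (b0 * fst c + a 1%nat * snd c, fst c)
  end.

(** If the tail's numerator vanishes, its denominator does not, and multiplying that by [a 1] keeps
    it nonzero. This makes [ratio] of a convergent meaningful. *)
Lemma convergent_nonzero (n : nat) : forall (b0 : C) (a b : nat -> C),
  (forall k, (1 <= k)%nat -> a k <> 0) ->
  fst (convergent b0 a b n) <> 0 \/ snd (convergent b0 a b n) <> 0.
Proof.
  induction n as [| n IH]; intros b0 a b Ha; simpl.
  - right; apply C1_nz.
  - set (c := convergent _ _ _ n).
    destruct (Ceq_dec (fst c) 0) as [H | H]; [left | now right].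
    destruct (IH (b 1%nat) (fun k => a (S k)) (fun k => b (S k))) as [H' | H'].
    + intros k Hk; apply Ha; lia.
    + contradiction.
    + rewrite H; intros H0; apply (Cmult_neq_0 (a 1%nat) (snd c)); auto.
      rewrite <- H0; ring.
Qed.

(** Each stage of [approximant] is a Moebius map, and [convergent] is its linear action on
    homogeneous coordinates; the cases check the conventions for 0 and [Inf]. *)
Lemma approximant_ratio (n : nat) : forall (b0 : C) (a b : nat -> C),
  (forall k, (1 <= k)%nat -> a k <> 0) ->
  approximant b0 a b n
  = ratio (fst (convergent b0 a b n)) (snd (convergent b0 a b n)).
Proof.
  induction n as [| n IH]; intros b0 a b Ha; simpl.
  - unfold ratio; destruct (Ceq_dec 1 0) as [H | H]; [now destruct (C1_nz H) |].
    f_equal; field.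
  - assert (Ha' : forall k, (1 <= k)%nat -> a (S k) <> 0)
      by (intros k Hk; apply Ha; lia).
    rewrite (IH _ _ _ Ha').
    assert (Hc := convergent_nonzero n (b 1%nat) _ (fun k => b (S k)) Ha').
    set (c := convergent _ _ _ n) in *; unfold ratio.
    destruct (Ceq_dec (snd c) 0) as [H1 | H1];
      destruct (Ceq_dec (fst c) 0) as [H2 | H2]; simpl.
    + tauto.
    + f_equal; rewrite H1; field; auto.
    + destruct (Ceq_dec (fst c / snd c) 0) as [_ | H]; [reflexivity |].
      contradict H; rewrite H2; field; auto.
    + destruct (Ceq_dec (fst c / snd c) 0) as [H |]; simpl.
      * contradict H2; replace (fst c) with (fst c / snd c * snd c) by (field; auto).
        rewrite H; ring.
      * f_equal; field; auto.
Qed.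

(** A Casoratian identity: the pairing of consecutive convergents with a
    solution [X] of the backward recurrence does not depend on [n]. *)
Lemma convergent_pairing (n : nat) : forall (b0 : C) (a b X : nat -> C),
  X O = b0 * X 1%nat + a 1%nat * X 2%nat ->
  (forall k, X (S k) = b (S k) * X (S (S k)) + a (S (S k)) * X (S (S (S k)))) ->
  fst (convergent b0 a b (S n)) * X (S (S n))
    + a (S (S n)) * fst (convergent b0 a b n) * X (S (S (S n))) = X O /\
  snd (convergent b0 a b (S n)) * X (S (S n))
    + a (S (S n)) * snd (convergent b0 a b n) * X (S (S (S n))) = X 1%nat.
Proof.
  induction n as [| n IH]; intros b0 a b X H0 HX.
  - simpl; rewrite H0, (HX O); split; ring.
  - destruct (IH (b 1%nat) (fun k => a (S k)) (fun k => b (S k)) (fun k => X (S k)))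
      as [I1 I2]; [apply HX | intros k; apply HX |].
    (* Hiding [S n] makes [simpl] unfold only the outermost level, so the tail pair stays
       recognisable. *)
    remember (S n) as m eqn:Em; simpl.
    set (c := convergent _ _ _ m) in *.
    rewrite Em; simpl.
    set (d := convergent _ _ _ n) in *.
    rewrite Em in I1, I2.
    (* The denominator of a convergent is the numerator of its tail, so the second claim is the
       first claim for the tail. *)
    split; [| exact I1].
    rewrite H0, <- I1, <- I2; ring.
Qed.

(** Dividing [convergent_pairing] by [X (n + 2)] gives A_(n+1) = X 0 / X (n+2) - c_n A_n with c_n
    tending to [al], and likewise for the denominators with [X 1]. By [Clim_linear_recurrence] the
    two limits are [X 0] and [X 1] times the same factor 1 / (L (1 + al)). *)
Theorem cf_converges_of_solution (F : contfrac) (X : nat -> C) (L al : C) :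
  (forall n, (1 <= n)%nat -> cf_num F n <> 0) ->
  X O = cf_first F * X 1%nat + cf_num F 1%nat * X 2%nat ->
  (forall k, X (S k) = cf_den F (S k) * X (S (S k))
                       + cf_num F (S (S k)) * X (S (S (S k)))) ->
  Clim X L -> L <> 0 -> Clim (cf_num F) al -> (Cmod al < 1)%R ->
  cf_converges F (ratio (X O) (X 1%nat)).
Proof.
  destruct F as [b0 a b]; simpl; intros Ha H0 HX HL HL0 Hal Hal1.
  split; [exact Ha |]; simpl.
  assert (Hpair := fun n => convergent_pairing n b0 a b X H0 HX).
  assert (HL2 : Clim (fun n => X (S (S n))) L)
    by (apply (Clim_S (fun n => X (S n))), Clim_S, HL).
  assert (HL3 : Clim (fun n => X (S (S (S n)))) L)
    by (apply (Clim_S (fun n => X (S (S n)))), HL2).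
  assert (Hal2 : Clim (fun n => a (S (S n))) al)
    by (apply (Clim_S (fun n => a (S n))), Clim_S, Hal).
  assert (Hc : Clim (fun n => a (S (S n)) * X (S (S (S n))) * / X (S (S n))) al).
  { replace al with (al * L * / L) by (field; auto).
    apply Clim_mult; [apply Clim_mult | apply Clim_inv]; auto. }
  assert (Hx : forall x, Clim (fun n => x * / X (S (S n))) (x * / L))
    by (intros x; apply Clim_mult; [apply Clim_const | apply Clim_inv]; auto).
  destruct (Clim_away_from_0 _ _ HL2 HL0) as [N HN].
  assert (HN' : forall n, (N <= n)%nat -> X (S (S n)) <> 0).
  { intros n Hn; apply Cmod_gt_0; specialize (HN n Hn).
    assert (H := Cmod_ge_0 L); lra. }
  assert (Hal3 : 1 + al <> 0).
  { intros H; replace al with (- (1)) in Hal1 by (rewrite <- (Cplus_0_r (- (1))), <- H; ring).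
    rewrite Cmod_m1 in Hal1; lra. }
  set (s := / (L * (1 + al))).
  assert (Hs : s <> 0) by (apply Cinv_neq_0, Cmult_neq_0; auto).
  assert (HA : Clim (fun n => fst (convergent b0 a b n)) (s * X O)).
  { replace (s * X O) with (X O * / L / (1 + al)) by (unfold s; field; auto).
    apply (Clim_linear_recurrence _ _ _ _ _ (Hx _) Hc Hal1).
    exists N; intros n Hn; rewrite <- (proj1 (Hpair n)); field; auto. }
  assert (HB : Clim (fun n => snd (convergent b0 a b n)) (s * X 1%nat)).
  { replace (s * X 1%nat) with (X 1%nat * / L / (1 + al)) by (unfold s; field; auto).
    apply (Clim_linear_recurrence _ _ _ _ _ (Hx _) Hc Hal1).
    exists N; intros n Hn; rewrite <- (proj2 (Hpair n)); field; auto. }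
  (* Two consecutive zeros of [X] would propagate upwards, the partial numerators being nonzero, and
     contradict the nonzero limit [L]. *)
  assert (HX01 : X O <> 0 \/ X 1%nat <> 0).
  { destruct (Ceq_dec (X O) 0) as [E0 |]; [| now left].
    destruct (Ceq_dec (X 1%nat) 0) as [E1 |]; [exfalso | now right].
    assert (E2 : X 2%nat = 0).
    { destruct (Ceq_dec (X 2%nat) 0) as [| E2]; [assumption |].
      exfalso; apply (Cmult_neq_0 _ _ (Ha 1%nat (le_n _)) E2).
      rewrite <- E0, H0, E1; ring. }
    assert (E : forall n, X (S n) = 0 /\ X (S (S n)) = 0).
    { induction n as [| n [I1 I2]]; [now split |]; split; [exact I2 |].
      destruct (Ceq_dec (X (S (S (S n)))) 0) as [| E3]; [assumption |].
      exfalso; refine (Cmult_neq_0 _ _ (Ha (S (S n)) _) E3 _); [lia |].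
      rewrite <- I1, (HX n), I2; ring. }
    apply (HN' N (le_n _)), E. }
  rewrite <- (ratio_scale s) by exact Hs.
  eapply filterlim_ext; [intros n; symmetry; now apply approximant_ratio |].
  apply ratio_lim; auto.
  destruct HX01; [left | right]; now apply Cmult_neq_0.
Qed.

(** * Sums of q-hypergeometric type *)

Lemma is_series_C_unique (u : nat -> C) (l m : C) :
  is_series (V := C_NormedModule) u l -> is_series (V := C_NormedModule) u m -> l = m.
Proof. apply filterlim_locally_unique. Qed.

Lemma is_series_norm_le {K : AbsRing} {V : NormedModule K}
  (u : nat -> V) (v : nat -> R) (l : V) (m : R) :
  (forall n, norm (u n) <= v n)%R -> is_series u l -> is_series v m ->
  (norm l <= m)%R.
Proof.
  intros Huv Hu Hv.
  apply (is_lim_seq_le (fun n => norm (sum_n u n)) (sum_n v) (norm l) m).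
  - intros n; induction n as [| n IH]; rewrite ?sum_O, ?sum_Sn; [apply Huv |].
    eapply Rle_trans; [apply norm_triangle | now apply Rplus_le_compat].
  - eapply filterlim_comp; [exact Hu | apply filterlim_norm].
  - exact Hv.
Qed.

(** A total operator obtained by unique choice; its value is meaningful only for convergent
    series. *)
Definition Csum (u : nat -> C) : C :=
  iota (T := C_CompleteNormedModule) (is_series (V := C_NormedModule) u).

Lemma Csum_correct (u : nat -> C) :
  ex_series (V := C_NormedModule) u -> is_series (V := C_NormedModule) u (Csum u).
Proof.
  intros [l Hl]; apply (iota_correct (V := C_CompleteNormedModule)
    (is_series (V := C_NormedModule) u)).
  exists l; split; [exact Hl |].
  intros m Hm; exact (is_series_C_unique u l m Hl Hm).
Qed.

(** For [p = q] and [p = q^2] these are q^(n(n+1)/2) / (q;q)_n and q^(n^2) / (q;q)_n. *)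
Fixpoint qcoef (q p : C) (n : nat) : C :=
  match n with
  | O => 1
  | S m => q * p ^ m / (1 - q ^ S m) * qcoef q p m
  end.

(** The weight [f] lets such sums be nested: [f n] will be an inner sum with arguments multiplied by
    [q ^ n], which produces the cross terms in the exponent of [q]. *)
Definition qsum (q p x : C) (f : nat -> C) : C :=
  Csum (fun n => qcoef q p n * x ^ n * f n).

Definition bounded_seq (f : nat -> C) : Prop :=
  exists K, forall n, (Cmod (f n) <= K)%R.

Lemma one_minus_qpow_ge (q : C) (n : nat) : (Cmod q < 1)%R ->
  (1 - Cmod q <= Cmod (1 - q ^ S n))%R.
Proof.
  intros Hq.
  assert (H := Cmod_triangle (1 - q ^ S n) (q ^ S n)).
  replace (1 - q ^ S n + q ^ S n) with (RtoC 1) in H by ring.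
  rewrite Cmod_1, Cmod_pow in H.
  assert (Cmod q ^ S n <= Cmod q)%R.
  { rewrite <- (Rmult_1_r (Cmod q)) at 2; simpl.
    apply Rmult_le_compat_l; [apply Cmod_ge_0 |].
    rewrite <- (pow1 n); apply pow_incr; split; [apply Cmod_ge_0 | lra]. }
  lra.
Qed.

Lemma one_minus_qpow_neq_0 (q : C) (n : nat) : (Cmod q < 1)%R ->
  1 - q ^ S n <> 0.
Proof.
  intros Hq; apply Cmod_gt_0; assert (H := one_minus_qpow_ge q n Hq); lra.
Qed.

Lemma qcoef_neq_0 (q p : C) (n : nat) :
  (0 < Cmod q < 1)%R -> (0 < Cmod p)%R -> qcoef q p n <> 0.
Proof.
  intros Hq Hp; induction n as [| n IH]; [apply C1_nz |].
  change (q * p ^ n / (1 - q ^ S n) * qcoef q p n <> 0).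
  repeat apply Cmult_neq_0; auto; try (apply Cmod_gt_0; lra).
  - apply Cpow_nz, Cmod_gt_0; lra.
  - apply Cinv_neq_0, one_minus_qpow_neq_0; lra.
Qed.

(** Ratio test: consecutive terms have quotient at most |q| r / (1 - |q|) times |p|^n, which tends
    to 0. So the series converges for every radius. *)
Lemma qcoef_summable (q p : C) (r : R) :
  (0 < Cmod q < 1)%R -> (0 < Cmod p < 1)%R -> (0 < r)%R ->
  ex_series (fun n => Cmod (qcoef q p n) * r ^ n)%R.
Proof.
  intros Hq Hp Hr.
  assert (Hd := fun n => proj1 (Cmod_gt_0 _) (qcoef_neq_0 q p n Hq (proj1 Hp))).
  assert (Hr' := fun n => pow_lt r n Hr).
  assert (Ht : forall n, (0 < Cmod (qcoef q p n) * r ^ n)%R)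
    by (intros; now apply Rmult_lt_0_compat).
  apply (ex_series_ext (fun n => Rabs (Cmod (qcoef q p n) * r ^ n)%R)).
  { intros n; apply Rabs_pos_eq, Rlt_le, Ht. }
  apply (ex_series_DAlembert _ 0); [lra | intros n; specialize (Ht n); lra |].
  apply (is_lim_seq_le_le (fun _ => 0%R) _
           (fun n => Cmod q * r / (1 - Cmod q) * Cmod p ^ n)%R).
  - intros n; split; [apply Rabs_pos |].
    rewrite Rabs_pos_eq by (apply Rlt_le, Rdiv_lt_0_compat; apply Ht).
    change (qcoef q p (S n)) with (q * p ^ n / (1 - q ^ S n) * qcoef q p n).
    unfold Cdiv; rewrite !Cmod_mult, Cmod_inv, Cmod_pow
      by (apply one_minus_qpow_neq_0; lra).
    assert (H := one_minus_qpow_ge q n (proj2 Hq)).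
    replace (Cmod q * Cmod p ^ n * / Cmod (1 - q ^ S n) * Cmod (qcoef q p n) * r ^ S n
              / (Cmod (qcoef q p n) * r ^ n))%R
      with (Cmod q * r * / Cmod (1 - q ^ S n) * Cmod p ^ n)%R.
    2:{ specialize (Hd n); specialize (Hr' n). change (r ^ S n)%R with (r * r ^ n)%R.
        field; repeat split; lra. }
    apply Rmult_le_compat_r; [apply pow_le; lra |].
    apply Rmult_le_compat_l; [apply Rmult_le_pos; lra |].
    apply Rinv_le_contravar; lra.
  - apply is_lim_seq_const.
  - replace (Finite 0) with (Finite (Cmod q * r / (1 - Cmod q) * 0)%R)
      by (f_equal; ring).
    apply is_lim_seq_mult'; [apply is_lim_seq_const |].
    apply is_lim_seq_geom; rewrite Rabs_pos_eq; lra.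
Qed.

Lemma qsum_is_series (q p x : C) (f : nat -> C) :
  (0 < Cmod q < 1)%R -> (0 < Cmod p < 1)%R -> bounded_seq f ->
  is_series (V := C_NormedModule) (fun n => qcoef q p n * x ^ n * f n) (qsum q p x f).
Proof.
  intros Hq Hp [K HK]; apply Csum_correct.
  assert (Hx := Cmod_ge_0 x).
  (* The majorant uses [Cmod x + 1] because [qcoef_summable] requires a positive radius, and [x] may
     be 0. *)
  apply (ex_series_le (V := C_CompleteNormedModule) _
           (fun n => K * (Cmod (qcoef q p n) * (Cmod x + 1) ^ n))%R).
  - intros n; change (norm ?z) with (Cmod z).
    rewrite !Cmod_mult, Cmod_pow, Rmult_comm.
    apply Rmult_le_compat; auto using Cmod_ge_0.
    + apply Rmult_le_pos; [apply Cmod_ge_0 | now apply pow_le].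
    + apply Rmult_le_compat_l; [apply Cmod_ge_0 |].
      apply pow_incr; lra.
  - apply (ex_series_scal (V := R_NormedModule)), qcoef_summable; auto; lra.
Qed.

(** Reduces identities between sums to termwise identities, as in the algebraic rules that
    follow. *)
Lemma qsum_unique (q p x : C) (f : nat -> C) (l : C) :
  (0 < Cmod q < 1)%R -> (0 < Cmod p < 1)%R -> bounded_seq f ->
  is_series (V := C_NormedModule) (fun n => qcoef q p n * x ^ n * f n) l ->
  l = qsum q p x f.
Proof.
  intros Hq Hp Hf Hl; eapply is_series_C_unique; [exact Hl |].
  now apply qsum_is_series.
Qed.

Lemma qsum_ext (q p x : C) (f g : nat -> C) :
  (0 < Cmod q < 1)%R -> (0 < Cmod p < 1)%R -> bounded_seq f ->
  (forall n, f n = g n) -> qsum q p x f = qsum q p x g.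
Proof.
  intros Hq Hp [K HK] E; apply qsum_unique; auto.
  - exists K; intros n; rewrite <- E; apply HK.
  - eapply is_series_ext; [| apply qsum_is_series; auto; now exists K].
    intros n; simpl; now rewrite E.
Qed.

Lemma bounded_seq_S (f : nat -> C) : bounded_seq f -> bounded_seq (fun n => f (S n)).
Proof. intros [K HK]; exists K; intros n; apply HK. Qed.

Lemma bounded_seq_minus (f g : nat -> C) :
  bounded_seq f -> bounded_seq g -> bounded_seq (fun n => f n - g n).
Proof.
  intros [K HK] [L HL]; exists (K + L)%R; intros n.
  eapply Rle_trans; [apply Cmod_triangle |]; rewrite Cmod_opp.
  now apply Rplus_le_compat.
Qed.

Lemma qsum_minus (q p x : C) (f g : nat -> C) :
  (0 < Cmod q < 1)%R -> (0 < Cmod p < 1)%R -> bounded_seq f -> bounded_seq g ->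
  qsum q p x f - qsum q p x g = qsum q p x (fun n => f n - g n).
Proof.
  intros Hq Hp Hf Hg; apply qsum_unique; auto using bounded_seq_minus.
  eapply is_series_ext.
  2: apply (is_series_minus (V := C_NormedModule)); apply qsum_is_series; eauto.
  intros n; unfold minus, plus, opp; simpl; ring.
Qed.

Lemma qsum_scal (q p x c : C) (f : nat -> C) :
  (0 < Cmod q < 1)%R -> (0 < Cmod p < 1)%R -> bounded_seq f ->
  qsum q p x (fun n => c * f n) = c * qsum q p x f.
Proof.
  intros Hq Hp Hf; symmetry; apply qsum_unique; auto.
  - destruct Hf as [K HK]; exists (Cmod c * K)%R; intros n; rewrite Cmod_mult.
    apply Rmult_le_compat_l; [apply Cmod_ge_0 | apply HK].
  - eapply is_series_ext.
    2: apply (is_series_scal (V := C_NormedModule)), qsum_is_series; eauto.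
    intros n; unfold scal; simpl; unfold mult; simpl; ring.
Qed.

(** The condition [Cmod r <= 1] keeps the weight bounded once [r ^ n] is absorbed into it. *)
Lemma qsum_dilate (q p x r : C) (f : nat -> C) :
  (0 < Cmod q < 1)%R -> (0 < Cmod p < 1)%R -> (Cmod r <= 1)%R -> bounded_seq f ->
  qsum q p (x * r) f = qsum q p x (fun n => r ^ n * f n).
Proof.
  intros Hq Hp Hr Hf; apply qsum_unique; auto.
  - destruct Hf as [K HK]; exists K; intros n; rewrite Cmod_mult, Cmod_pow.
    apply Rle_trans with (2 := HK n); rewrite <- (Rmult_1_l (Cmod (f n))) at 2.
    apply Rmult_le_compat_r; [apply Cmod_ge_0 |].
    rewrite <- (pow1 n); apply pow_incr; split; [apply Cmod_ge_0 | exact Hr].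
  - eapply is_series_ext; [| now apply qsum_is_series].
    intros n; simpl; rewrite Cpow_mult_l; ring.
Qed.

(** Subtracting the sum at [x * q] multiplies the n-th term by 1 - q^n. This kills the term of index
    0 and cancels the newest denominator of [qcoef], leaving q p^n times the previous coefficient.
    All recurrences for G stem from this. *)
Lemma qsum_shift (q p x : C) (f : nat -> C) :
  (0 < Cmod q < 1)%R -> (0 < Cmod p < 1)%R -> bounded_seq f ->
  qsum q p x f
  = qsum q p (x * q) f + x * q * qsum q p (x * p) (fun n => f (S n)).
Proof.
  intros Hq Hp Hf.
  cut (qsum q p x f - qsum q p (x * q) f
       = x * q * qsum q p (x * p) (fun n => f (S n))).
  { intros <-; ring. }
  eapply is_series_C_unique.
  - apply (is_series_minus (V := C_NormedModule)); apply qsum_is_series; eauto.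
  - apply (is_series_decr_1 (V := C_NormedModule)).
    eapply is_series_ext.
    2:{ match goal with |- is_series _ ?l =>
          replace l with (scal (x * q : C_AbsRing)
            (qsum q p (x * p) (fun n => f (S n)) : C_NormedModule)) end.
        - apply (is_series_scal (V := C_NormedModule)), qsum_is_series;
            auto using bounded_seq_S.
        - unfold scal, plus, minus, opp; simpl; unfold mult, plus, opp; simpl; ring. }
    intros n; unfold scal, minus, plus, opp; simpl; unfold mult; simpl.
    assert (H := one_minus_qpow_neq_0 q n (proj2 Hq)); simpl in H.
    rewrite !Cpow_mult_l; field; exact H.
Qed.

(** The base is [r + 1]: for [r >= 0] it is positive, as summability needs, and at least 1, so its
    powers increase. *)
Definition qconst (q p : C) (r : R) : R :=
  Series (fun n => Cmod (qcoef q p n) * (r + 1) ^ n)%R.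

(** Both bounds are uniform over the disc of radius [r]. For the second, the term of index 0 is
    [f O], and every later term contains a factor [x]. *)
Lemma qsum_estimates (q p x : C) (f : nat -> C) (r K : R) :
  (0 < Cmod q < 1)%R -> (0 < Cmod p < 1)%R -> (Cmod x <= r)%R ->
  (forall n, (Cmod (f n) <= K)%R) ->
  (Cmod (qsum q p x f) <= qconst q p r * K)%R /\
  (Cmod (qsum q p x f - f O) <= qconst q p r * K * Cmod x)%R.
Proof.
  intros Hq Hp Hx HK.
  assert (Hx0 := Cmod_ge_0 x).
  assert (HK0 := Rle_trans _ _ _ (Cmod_ge_0 _) (HK O)).
  assert (Hf : is_series (V := C_NormedModule) _ (qsum q p x f))
    by (apply qsum_is_series; auto; now exists K).
  assert (Hs := Series_correct _ (qcoef_summable q p (r + 1) Hq Hp ltac:(lra))).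
  fold (qconst q p r) in Hs.
  split.
  - apply (is_series_scal (V := R_NormedModule) K) in Hs.
    rewrite Rmult_comm.
    refine (is_series_norm_le _ _ _ _ _ Hf Hs); intros n.
    change (norm ?z) with (Cmod z); unfold scal; simpl; unfold mult; simpl.
    rewrite !Cmod_mult, Cmod_pow, Rmult_comm.
    apply Rmult_le_compat; auto using Cmod_ge_0.
    + apply Rmult_le_pos; [apply Cmod_ge_0 | now apply pow_le].
    + apply Rmult_le_compat_l; [apply Cmod_ge_0 |].
      apply pow_incr; lra.
  - assert (Hf1 : is_series (V := C_NormedModule)
              (fun n => qcoef q p (S n) * x ^ S n * f (S n)) (qsum q p x f - f O)).
    { apply (is_series_incr_1 (V := C_NormedModule)
               (fun n => qcoef q p n * x ^ n * f n)).
      replace (plus _ _) with (qsum q p x f); [exact Hf |].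
      unfold plus; simpl; ring. }
    assert (Hs1 : is_series (fun n => Cmod (qcoef q p (S n)) * (r + 1) ^ S n)%R
                    (qconst q p r - 1)%R).
    { apply (is_series_incr_1 (V := R_NormedModule)
               (fun n => Cmod (qcoef q p n) * (r + 1) ^ n)%R).
      match goal with |- is_series _ ?l => replace l with (qconst q p r) end;
        [exact Hs |].
      unfold plus; simpl; rewrite Cmod_1; ring. }
    apply (is_series_scal (V := R_NormedModule) (K * Cmod x)%R) in Hs1.
    (* The majorant without its initial term, which is 1, sums to [qconst q p r - 1]. *)
    apply Rle_trans with (K * Cmod x * (qconst q p r - 1))%R.
    2:{ assert (0 <= K * Cmod x)%R by (now apply Rmult_le_pos); nra. }
    refine (is_series_norm_le _ _ _ _ _ Hf1 Hs1); intros n.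
    change (norm ?z) with (Cmod z); unfold scal; simpl (AbsRing.sort _);
      simpl ModuleSpace.scal; unfold mult; simpl (Ring.mult _).
    change (Cmod (qcoef q p (S n) * x ^ S n * f (S n))
      <= K * Cmod x * (Cmod (qcoef q p (S n)) * (r + 1) ^ S n))%R.
    rewrite !Cmod_mult, Cmod_pow.
    replace (K * Cmod x * (Cmod (qcoef q p (S n)) * (r + 1) ^ S n))%R
      with (Cmod (qcoef q p (S n)) * (Cmod x * (r + 1) ^ S n) * K)%R by ring.
    apply Rmult_le_compat; auto using Cmod_ge_0.
    + apply Rmult_le_pos; [apply Cmod_ge_0 | now apply pow_le].
    + apply Rmult_le_compat_l; [apply Cmod_ge_0 |].
      change (Cmod x ^ S n)%R with (Cmod x * Cmod x ^ n)%R.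
      apply Rmult_le_compat_l; [exact Hx0 |].
      apply Rle_trans with ((r + 1) ^ n)%R; [apply pow_incr; lra |].
      apply Rle_pow; [lra | lia].
Qed.

Lemma qconst_ge_0 (q p : C) (r : R) :
  (0 < Cmod q < 1)%R -> (0 < Cmod p < 1)%R -> (0 <= r)%R -> (0 <= qconst q p r)%R.
Proof.
  intros Hq Hp Hr.
  destruct (qsum_estimates q p 0 (fun _ => 1) r 1 Hq Hp) as [H _].
  - rewrite Cmod_0; exact Hr.
  - intros _; rewrite Cmod_1; lra.
  - rewrite Rmult_1_r in H; eapply Rle_trans; [apply Cmod_ge_0 | exact H].
Qed.

(** * The function G *)

(** Euler's series for the infinite product of 1 + b q^k over k >= 1; this is G(0,b,0). *)
Definition qexp (q b : C) : C := qsum q q b (fun _ => 1).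

(** The double series G(a,b,0), summed over the exponent of [b] inside and that of [a] outside. *)
Definition qexp2 (q a b : C) : C := qsum q q a (fun n => qexp q (b * q ^ n)).

(** The triple series G of the header, summed first over the exponent of [b],
    then over that of [a], then over that of [l]. *)
Definition rama (q a b l : C) : C :=
  qsum q (q ^ 2) l (fun n => qexp2 q (a * q ^ n) (b * q ^ n)).

(** * Bounds for G near vanishing arguments *)

Lemma Cmod_qpow_le (q x : C) (n : nat) :
  (0 < Cmod q < 1)%R -> (Cmod (x * q ^ n) <= Cmod x)%R.
Proof.
  intros Hq; rewrite Cmod_mult, Cmod_pow; apply Rle_trans with (Cmod x * 1)%R; [| lra].
  apply Rmult_le_compat_l; [apply Cmod_ge_0 |].
  rewrite <- (pow1 n); apply pow_incr; lra.
Qed.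

Lemma Cmod_sqr_lt_1 (q : C) : (0 < Cmod q < 1)%R -> (0 < Cmod (q ^ 2) < 1)%R.
Proof. intros Hq; rewrite Cmod_pow; simpl; nra. Qed.

Lemma qexp_estimates (q : C) (r : R) : (0 < Cmod q < 1)%R -> (0 <= r)%R ->
  exists M, (0 <= M)%R /\ forall b, (Cmod b <= r)%R ->
    (Cmod (qexp q b) <= M)%R /\ (Cmod (qexp q b - 1) <= M * Cmod b)%R.
Proof.
  intros Hq Hr; exists (qconst q q r * 1)%R; split.
  - rewrite Rmult_1_r; now apply qconst_ge_0.
  - intros b Hb; apply (qsum_estimates q q b (fun _ => 1) r 1); auto.
    intros _; rewrite Cmod_1; lra.
Qed.

Lemma qexp_bounded_seq (q b : C) : (0 < Cmod q < 1)%R ->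
  bounded_seq (fun n => qexp q (b * q ^ n)).
Proof.
  intros Hq; destruct (qexp_estimates q (Cmod b) Hq (Cmod_ge_0 b)) as [M [_ HM]].
  exists M; intros n; apply HM; now apply Cmod_qpow_le.
Qed.

Lemma bounded_seq_const (c : C) : bounded_seq (fun _ => c).
Proof. exists (Cmod c); intros _; apply Rle_refl. Qed.

(** Dropping [a] truncates the outer sum at index 0. Dropping [b] replaces each inner sum by 1, at a
    cost controlled by [qexp_estimates]. *)
Lemma qexp2_estimates (q : C) (r : R) : (0 < Cmod q < 1)%R -> (0 <= r)%R ->
  exists M, (0 <= M)%R /\ forall a b, (Cmod a <= r)%R -> (Cmod b <= r)%R ->
    (Cmod (qexp2 q a b) <= M)%R /\
    (Cmod (qexp2 q a b - qexp q b) <= M * Cmod a)%R /\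
    (Cmod (qexp2 q a b - qexp q a) <= M * Cmod b)%R.
Proof.
  intros Hq Hr; destruct (qexp_estimates q r Hq Hr) as [K [HK0 HK]].
  exists (qconst q q r * K)%R; split.
  - apply Rmult_le_pos; [now apply qconst_ge_0 | exact HK0].
  - intros a b Ha Hb.
    assert (Hbn : forall n, (Cmod (b * q ^ n) <= r)%R)
      by (intros n; apply Rle_trans with (2 := Hb); now apply Cmod_qpow_le).
    destruct (qsum_estimates q q a (fun n => qexp q (b * q ^ n)) r K) as [H1 H2];
      auto; [intros n; now apply HK |].
    split; [exact H1 | split].
    + replace (b * q ^ 0) with b in H2 by (simpl; ring); exact H2.
    (* Only [qexp q a] is unfolded: as a sum over the same [a] with weight 1, it can be subtracted
       termwise. *)
    + unfold qexp2; unfold qexp at 2.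
      rewrite qsum_minus; auto using qexp_bounded_seq, bounded_seq_const.
      rewrite Rmult_assoc; apply (qsum_estimates q q a _ r); auto; intros n.
      eapply Rle_trans; [now apply HK |].
      apply Rmult_le_compat_l; [exact HK0 | now apply Cmod_qpow_le].
Qed.

Lemma qexp2_bounded_seq (q a b : C) : (0 < Cmod q < 1)%R ->
  bounded_seq (fun n => qexp2 q (a * q ^ n) (b * q ^ n)).
Proof.
  intros Hq.
  destruct (qexp2_estimates q (Rmax (Cmod a) (Cmod b)) Hq) as [M [_ HM]].
  - eapply Rle_trans; [apply (Cmod_ge_0 a) | apply Rmax_l].
  - exists M; intros n; apply HM;
      (eapply Rle_trans; [now apply Cmod_qpow_le |]); [apply Rmax_l | apply Rmax_r].
Qed.

(** Truncating the sum in [l] leaves [qexp2] with error O(|l|); [qexp2_estimates] then removes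
    either [a] or [b]. Both versions occur, since [F3] keeps [b] fixed and [F4] keeps the first
    argument fixed after one step. *)
Lemma rama_estimates (q : C) (r : R) : (0 < Cmod q < 1)%R -> (0 <= r)%R ->
  exists M, (0 <= M)%R /\ forall a b l,
    (Cmod a <= r)%R -> (Cmod b <= r)%R -> (Cmod l <= r)%R ->
    (Cmod (rama q a b l - qexp q b) <= M * (Cmod a + Cmod l))%R /\
    (Cmod (rama q a b l - qexp q a) <= M * (Cmod b + Cmod l))%R.
Proof.
  intros Hq Hr; destruct (qexp2_estimates q r Hq Hr) as [K [HK0 HK]].
  assert (Hq2 := Cmod_sqr_lt_1 q Hq).
  assert (HC := qconst_ge_0 q (q ^ 2) r Hq Hq2 Hr).
  set (M := (qconst q (q ^ 2) r * K)%R).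
  assert (HM : (0 <= M)%R) by now apply Rmult_le_pos.
  exists (M + K)%R; split; [lra |].
  intros a b l Ha Hb Hl.
  assert (H1 : (Cmod (rama q a b l - qexp2 q a b) <= M * Cmod l)%R).
  { destruct (qsum_estimates q (q ^ 2) l
      (fun n => qexp2 q (a * q ^ n) (b * q ^ n)) r K) as [_ H]; auto.
    - intros n; apply HK; (eapply Rle_trans; [now apply Cmod_qpow_le | auto]).
    - replace (a * q ^ 0) with a in H by (simpl; ring).
      replace (b * q ^ 0) with b in H by (simpl; ring); exact H. }
  destruct (HK a b Ha Hb) as [_ [H2 H3]].
  assert (Ha0 := Cmod_ge_0 a); assert (Hb0 := Cmod_ge_0 b);
    assert (Hl0 := Cmod_ge_0 l).
  split.
  - replace (rama q a b l - qexp q b)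
      with ((rama q a b l - qexp2 q a b) + (qexp2 q a b - qexp q b)) by ring.
    eapply Rle_trans; [apply Cmod_triangle | nra].
  - replace (rama q a b l - qexp q a)
      with ((rama q a b l - qexp2 q a b) + (qexp2 q a b - qexp q a)) by ring.
    eapply Rle_trans; [apply Cmod_triangle | nra].
Qed.

(** * Functional equations of G in each argument *)

Lemma qexp_rec (q b : C) : (0 < Cmod q < 1)%R ->
  qexp q b = (1 + b * q) * qexp q (b * q).
Proof.
  intros Hq; unfold qexp at 1; rewrite qsum_shift; auto using bounded_seq_const.
  unfold qexp; ring.
Qed.

Lemma qexp2_rec_l (q a b : C) : (0 < Cmod q < 1)%R ->
  qexp2 q a b = qexp2 q (a * q) b + a * q * qexp2 q (a * q) (b * q).
Proof.
  intros Hq; unfold qexp2 at 1; rewrite qsum_shift; auto using qexp_bounded_seq.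
  f_equal; f_equal; apply qsum_ext; auto.
  - exact (bounded_seq_S _ (qexp_bounded_seq q b Hq)).
  - intros n; f_equal; rewrite Cpow_S; ring.
Qed.

Lemma bounded_seq_qpow (q : C) (f : nat -> C) : (0 < Cmod q < 1)%R ->
  bounded_seq f -> bounded_seq (fun n => q ^ n * f n).
Proof.
  intros Hq [K HK]; exists K; intros n.
  rewrite Cmult_comm; eapply Rle_trans; [now apply Cmod_qpow_le | apply HK].
Qed.

(** Here [b] sits in the inner sum, so [qexp_rec] is applied termwise; the factor [q ^ n] it
    produces is absorbed by dilating [a] to [a * q]. *)
Lemma qexp2_rec_r (q a b : C) : (0 < Cmod q < 1)%R ->
  qexp2 q a b = qexp2 q a (b * q) + b * q * qexp2 q (a * q) (b * q).
Proof.
  intros Hq; assert (Hb := qexp_bounded_seq q b Hq).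
  assert (Hb' := qexp_bounded_seq q (b * q) Hq).
  cut (qexp2 q a b - qexp2 q a (b * q) = b * q * qexp2 q (a * q) (b * q)).
  { intros <-; ring. }
  unfold qexp2; rewrite qsum_minus, qsum_dilate, <- qsum_scal; auto; try lra.
  - apply qsum_ext; auto using bounded_seq_minus.
    intros n; rewrite (qexp_rec q (b * q ^ n)) by exact Hq.
    replace (b * q ^ n * q) with (b * q * q ^ n) by ring; ring.
  - now apply bounded_seq_qpow.
Qed.

(** The difference passes inside the sum over the exponent of [l], where [qexp2_rec_l] yields a
    factor [q ^ n]; that factor dilates [l] to [l * q]. [rama_rec_b] works the same way with
    [qexp2_rec_r]. *)
Lemma rama_rec_a (q a b l : C) : (0 < Cmod q < 1)%R ->
  rama q a b l = rama q (a * q) b l + a * q * rama q (a * q) (b * q) (l * q).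
Proof.
  intros Hq; assert (Hq2 := Cmod_sqr_lt_1 q Hq).
  cut (rama q a b l - rama q (a * q) b l
       = a * q * rama q (a * q) (b * q) (l * q)).
  { intros <-; ring. }
  unfold rama; rewrite qsum_minus, qsum_dilate, <- qsum_scal;
    auto using qexp2_bounded_seq, bounded_seq_qpow; try lra.
  apply qsum_ext; auto using qexp2_bounded_seq, bounded_seq_minus.
  intros n; rewrite (qexp2_rec_l q (a * q ^ n)) by exact Hq.
  replace (a * q ^ n * q) with (a * q * q ^ n) by ring.
  replace (b * q ^ n * q) with (b * q * q ^ n) by ring; ring.
Qed.

Lemma rama_rec_b (q a b l : C) : (0 < Cmod q < 1)%R ->
  rama q a b l = rama q a (b * q) l + b * q * rama q (a * q) (b * q) (l * q).
Proof.
  intros Hq; assert (Hq2 := Cmod_sqr_lt_1 q Hq).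
  cut (rama q a b l - rama q a (b * q) l
       = b * q * rama q (a * q) (b * q) (l * q)).
  { intros <-; ring. }
  unfold rama; rewrite qsum_minus, qsum_dilate, <- qsum_scal;
    auto using qexp2_bounded_seq, bounded_seq_qpow; try lra.
  apply qsum_ext; auto using qexp2_bounded_seq, bounded_seq_minus.
  intros n; rewrite (qexp2_rec_r q (a * q ^ n)) by exact Hq.
  replace (a * q ^ n * q) with (a * q * q ^ n) by ring.
  replace (b * q ^ n * q) with (b * q * q ^ n) by ring; ring.
Qed.

(** The sum in [l] is outermost, so [qsum_shift] applies directly; its base [p = q ^ 2] accounts for
    the [l * q * q]. *)
Lemma rama_rec_l (q a b l : C) : (0 < Cmod q < 1)%R ->
  rama q a b l
  = rama q a b (l * q) + l * q * rama q (a * q) (b * q) (l * q * q).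
Proof.
  intros Hq; assert (Hq2 := Cmod_sqr_lt_1 q Hq).
  unfold rama at 1; rewrite qsum_shift; auto using qexp2_bounded_seq.
  replace (l * q * q) with (l * q ^ 2) by ring.
  f_equal; f_equal; apply qsum_ext; auto.
  - exact (bounded_seq_S _ (qexp2_bounded_seq q a b Hq)).
  - intros n; f_equal; rewrite Cpow_S; ring.
Qed.

Lemma geom_lim_0 (q : C) (M : R) : (0 < Cmod q < 1)%R ->
  is_lim_seq (fun n => M * Cmod q ^ n)%R 0%R.
Proof.
  intros Hq; replace (Finite 0) with (Finite (M * 0)%R) by (f_equal; ring).
  apply is_lim_seq_mult'; [apply is_lim_seq_const |].
  apply is_lim_seq_geom; rewrite Rabs_pos_eq; lra.
Qed.

Lemma Clim_qpow (q c : C) : (0 < Cmod q < 1)%R -> Clim (fun n => c * q ^ n) 0.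
Proof.
  intros Hq; apply (Clim_squeeze _ _ (fun n => Cmod c * Cmod q ^ n)%R);
    [| now apply geom_lim_0].
  exists 0%nat; intros n _; replace (c * q ^ n - 0) with (c * q ^ n) by ring.
  rewrite Cmod_mult, Cmod_pow; apply Rle_refl.
Qed.

(** By [qexp_rec] a zero at [b] passes to every [b * q ^ n], the factors 1 + b q^(n+1) being
    nonzero; but the values there tend to 1. *)
Lemma qexp_neq_0 (q b : C) : (0 < Cmod q < 1)%R -> (Cmod (b * q) < 1)%R ->
  qexp q b <> 0.
Proof.
  intros Hq Hb H.
  assert (Hn : forall n, qexp q (b * q ^ n) = 0).
  { induction n as [| n IH]; [simpl; rewrite Cmult_1_r; exact H |].
    rewrite qexp_rec in IH by exact Hq.
    replace (b * q ^ S n) with (b * q ^ n * q) by (simpl; ring).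
    destruct (Ceq_dec (qexp q (b * q ^ n * q)) 0) as [| H0]; [assumption |].
    exfalso; apply (fun H1 => Cmult_neq_0 _ _ H1 H0 IH); intros H1.
    assert (H2 := Cmod_qpow_le q (b * q) n Hq).
    replace (b * q * q ^ n) with (- (1)) in H2.
    - rewrite Cmod_m1 in H2; lra.
    - rewrite <- (Cplus_0_r (- (1))), <- H1; ring. }
  destruct (qexp_estimates q (Cmod b) Hq (Cmod_ge_0 b)) as [M [_ HM]].
  assert (HL := geom_lim_0 q (M * Cmod b) Hq).
  apply is_lim_seq_spec in HL.
  destruct (HL (mkposreal 1 Rlt_0_1)) as [N HN]; specialize (HN N (le_n _)).
  simpl in HN; apply Rabs_def2 in HN.
  destruct (HM (b * q ^ N)) as [_ H1]; [now apply Cmod_qpow_le |].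
  rewrite Hn, Cmod_mult, Cmod_pow in H1.
  replace (0 - 1) with (- (1)) in H1 by ring; rewrite Cmod_m1 in H1; lra.
Qed.

(** * The four continued fractions *)

(** After expanding in [a] and [l], the terms a l q^3 G(aq^2,bq^2,lq^3) cancel. [rama_F1_even]
    exchanges the roles of [a] and [b]. *)
Lemma rama_F1_odd (q a b l : C) : (0 < Cmod q < 1)%R ->
  rama q a b l = rama q (a * q) b (l * q)
    + (a * q + l * q) * rama q (a * q) (b * q) (l * q * q).
Proof.
  intros Hq.
  rewrite (rama_rec_a q a b l), (rama_rec_l q (a * q) b l),
    (rama_rec_l q (a * q) (b * q) (l * q)),
    (rama_rec_a q (a * q) (b * q) (l * q * q)) by exact Hq; ring.
Qed.

Lemma rama_F1_even (q a b l : C) : (0 < Cmod q < 1)%R ->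
  rama q a b l = rama q a (b * q) (l * q)
    + (b * q + l * q) * rama q (a * q) (b * q) (l * q * q).
Proof.
  intros Hq.
  rewrite (rama_rec_b q a b l), (rama_rec_l q a (b * q) l),
    (rama_rec_l q (a * q) (b * q) (l * q)),
    (rama_rec_b q (a * q) (b * q) (l * q * q)) by exact Hq; ring.
Qed.

(** The first step of [F2] leaves [b] in place, so its coefficients differ from those of the later
    steps in [rama_F2]. *)
Lemma rama_F2_head (q a b l : C) : (0 < Cmod q < 1)%R ->
  rama q a b l = (1 + a * q) * rama q (a * q) b (l * q)
    + (l * q - a * b * (q * q)) * rama q (a * q * q) (b * q) (l * q * q).
Proof.
  intros Hq.
  rewrite (rama_rec_a q a b l), (rama_rec_l q (a * q) b l),
    (rama_rec_b q (a * q) b (l * q)) by exact Hq; ring.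
Qed.

Lemma rama_F2 (q a b l : C) : (0 < Cmod q < 1)%R ->
  rama q a b l = (1 + b * q + a * q) * rama q (a * q) (b * q) (l * q)
    + (l * q - a * b * (q * q * q)) * rama q (a * q * q) (b * q * q) (l * q * q).
Proof.
  intros Hq.
  rewrite (rama_F2_head q a b l), (rama_rec_b q (a * q) b (l * q)),
    (rama_rec_a q (a * q) (b * q) (l * q)),
    (rama_rec_l q (a * q * q) (b * q) (l * q)),
    (rama_rec_b q (a * q * q) (b * q) (l * q * q)) by exact Hq; ring.
Qed.

(** Both [F1] recurrences at (aq, b, lq) involve the same G(aq^2,bq,lq^3). Eliminating the other two
    values leaves it with coefficients that agree because (aq + lq)(bq + lq^2) = (lq + b)(aq^2 +
    lq^2). [rama_F4] is the analogue based at (a, bq, lq). *)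
Lemma rama_F3 (q a b l : C) : (0 < Cmod q < 1)%R ->
  rama q a b l = (1 - b + a * q) * rama q (a * q) b (l * q)
    + (l * q + b) * rama q (a * q * q) b (l * q * q).
Proof.
  intros Hq.
  assert (H1 := rama_F1_odd q (a * q) b (l * q) Hq).
  assert (H2 := rama_F1_even q (a * q) b (l * q) Hq).
  rewrite (rama_F1_odd q a b l) by exact Hq.
  replace (rama q (a * q * q) b (l * q * q)) with
    (rama q (a * q) b (l * q) - (a * q * q + l * q * q)
       * rama q (a * q * q) (b * q) (l * q * q * q)) by (rewrite H1; ring).
  replace (rama q (a * q) (b * q) (l * q * q)) with
    (rama q (a * q) b (l * q) - (b * q + l * q * q)
       * rama q (a * q * q) (b * q) (l * q * q * q)) by (rewrite H2; ring).
  ring.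
Qed.

Lemma rama_F4 (q a b l : C) : (0 < Cmod q < 1)%R ->
  rama q a b l = (1 - a + b * q) * rama q a (b * q) (l * q)
    + (a + l * q) * rama q a (b * q * q) (l * q * q).
Proof.
  intros Hq.
  assert (H1 := rama_F1_odd q a (b * q) (l * q) Hq).
  assert (H2 := rama_F1_even q a (b * q) (l * q) Hq).
  rewrite (rama_F1_even q a b l) by exact Hq.
  replace (rama q a (b * q * q) (l * q * q)) with
    (rama q a (b * q) (l * q) - (b * q * q + l * q * q)
       * rama q (a * q) (b * q * q) (l * q * q * q)) by (rewrite H2; ring).
  replace (rama q (a * q) (b * q) (l * q * q)) with
    (rama q a (b * q) (l * q) - (a * q + l * q * q)
       * rama q (a * q) (b * q * q) (l * q * q * q)) by (rewrite H1; ring).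
  ring.
Qed.

(** * Limits of G along sequences of arguments *)

Lemma Clim_0_Cmod (u : nat -> C) : Clim u 0 -> is_lim_seq (fun n => Cmod (u n)) 0%R.
Proof.
  intros Hu; eapply is_lim_seq_ext; [| exact Hu].
  intros n; simpl; f_equal; ring.
Qed.

Lemma Clim_0_small (u : nat -> C) : Clim u 0 ->
  exists N, forall n, (N <= n)%nat -> (Cmod (u n) <= 1)%R.
Proof.
  intros Hu; destruct (Clim_eventually _ _ 1 Hu Rlt_0_1) as [N HN].
  exists N; intros n Hn; specialize (HN n Hn).
  replace (u n - 0) with (u n) in HN by ring; lra.
Qed.

Lemma lim_weighted_sum (M : R) (u v : nat -> C) : Clim u 0 -> Clim v 0 ->
  is_lim_seq (fun n => M * (Cmod (u n) + Cmod (v n)))%R 0%R.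
Proof.
  intros Hu Hv; replace (Finite 0) with (Finite (M * (0 + 0))%R) by (f_equal; ring).
  apply is_lim_seq_mult'; [apply is_lim_seq_const |].
  apply is_lim_seq_plus'; now apply Clim_0_Cmod.
Qed.

Lemma rama_lim_al (q b : C) (u v : nat -> C) : (0 < Cmod q < 1)%R ->
  Clim u 0 -> Clim v 0 -> Clim (fun n => rama q (u n) b (v n)) (qexp q b).
Proof.
  intros Hq Hu Hv.
  (* This radius covers the fixed [b] as well as [u n] and [v n], which are eventually in the unit
     disc. *)
  destruct (rama_estimates q (Rmax (Cmod b) 1) Hq) as [M [_ HM]].
  { eapply Rle_trans; [apply (Cmod_ge_0 b) | apply Rmax_l]. }
  destruct (Clim_0_small u Hu) as [N1 H1]; destruct (Clim_0_small v Hv) as [N2 H2].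
  apply (Clim_squeeze _ _ (fun n => M * (Cmod (u n) + Cmod (v n)))%R);
    [| now apply lim_weighted_sum].
  exists (N1 + N2)%nat; intros n Hn; apply HM; [| apply Rmax_l |];
    (eapply Rle_trans; [| apply Rmax_r]); [apply H1 | apply H2]; lia.
Qed.

Lemma rama_lim_bl (q a : C) (u v : nat -> C) : (0 < Cmod q < 1)%R ->
  Clim u 0 -> Clim v 0 -> Clim (fun n => rama q a (u n) (v n)) (qexp q a).
Proof.
  intros Hq Hu Hv.
  destruct (rama_estimates q (Rmax (Cmod a) 1) Hq) as [M [_ HM]].
  { eapply Rle_trans; [apply (Cmod_ge_0 a) | apply Rmax_l]. }
  destruct (Clim_0_small u Hu) as [N1 H1]; destruct (Clim_0_small v Hv) as [N2 H2].
  apply (Clim_squeeze _ _ (fun n => M * (Cmod (u n) + Cmod (v n)))%R);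
    [| now apply lim_weighted_sum].
  exists (N1 + N2)%nat; intros n Hn; apply HM; [apply Rmax_l | |];
    (eapply Rle_trans; [| apply Rmax_r]); [apply H1 | apply H2]; lia.
Qed.

Lemma rama_lim_abl (q : C) (u v w : nat -> C) : (0 < Cmod q < 1)%R ->
  Clim u 0 -> Clim v 0 -> Clim w 0 -> Clim (fun n => rama q (u n) (v n) (w n)) 1.
Proof.
  intros Hq Hu Hv Hw.
  destruct (rama_estimates q 1 Hq Rle_0_1) as [M [_ HM]].
  destruct (qexp_estimates q 1 Hq Rle_0_1) as [K [_ HK]].
  destruct (Clim_0_small u Hu) as [N1 H1]; destruct (Clim_0_small v Hv) as [N2 H2];
    destruct (Clim_0_small w Hw) as [N3 H3].
  apply (Clim_squeeze _ _
    (fun n => M * (Cmod (u n) + Cmod (w n)) + K * Cmod (v n))%R).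
  - exists (N1 + N2 + N3)%nat; intros n Hn.
    replace (rama q (u n) (v n) (w n) - 1) with
      ((rama q (u n) (v n) (w n) - qexp q (v n)) + (qexp q (v n) - 1)) by ring.
    eapply Rle_trans; [apply Cmod_triangle | apply Rplus_le_compat].
    + apply HM; [apply H1 | apply H2 | apply H3]; lia.
    + apply HK, H2; lia.
  - replace (Finite 0) with (Finite (0 + K * 0)%R) by (f_equal; ring).
    apply is_lim_seq_plus'; [now apply lim_weighted_sum |].
    apply is_lim_seq_mult'; [apply is_lim_seq_const | now apply Clim_0_Cmod].
Qed.

Lemma Clim_half (u : nat -> C) (l : C) : Clim u l -> Clim (fun n => u (n / 2)%nat) l.
Proof.
  intros Hu; apply (is_lim_seq_subseq (fun n => Cmod (u n - l)) _ (fun n => n / 2)%nat);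
    [| exact Hu].
  intros P [N HN]; exists (N * 2)%nat; intros n Hn; apply HN.
  apply Nat.div_le_lower_bound; lia.
Qed.

Lemma qpow_S (q x : C) (n : nat) : x * q ^ S n = x * q ^ n * q.
Proof. rewrite Cpow_S; ring. Qed.

Lemma Clim_qpow_mult (q c : C) : (0 < Cmod q < 1)%R ->
  Clim (fun n => c * q ^ n * q) 0.
Proof.
  intros Hq; eapply is_lim_seq_ext; [| exact (Clim_qpow q (c * q) Hq)].
  intros n; simpl; f_equal; ring.
Qed.

(** * Convergence of each continued fraction to the same ratio *)

Lemma F1_converges (a b lam q : C) : (0 < Cmod q < 1)%R ->
  (forall n, a + lam * q ^ n <> 0) -> (forall n, b + lam * q ^ S n <> 0) ->
  cf_converges (F1 a b lam q)
    (ratio (rama q a b lam) (rama q (a * q) b (lam * q))).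
Proof.
  intros Hq nz_a nz_b.
  assert (Hqn : forall n, q ^ n <> 0) by (intros n; apply Cpow_nz, Cmod_gt_0; lra).
  assert (E1 : forall i, (S (2 * i) / 2)%nat = i)
    by (intros i; rewrite <- Nat.div2_div; apply Nat.div2_succ_double).
  assert (E0 : forall i, (2 * i / 2)%nat = i)
    by (intros i; rewrite <- Nat.div2_div; apply Nat.div2_double).
  assert (ES : forall k, (S (S k) / 2)%nat = S (k / 2))
    by (intros k; rewrite <- !Nat.div2_div; reflexivity).
  assert (Hpar : forall k, exists i, k = (2 * i)%nat \/ k = S (2 * i)).
  { intros k; destruct (Nat.Even_or_Odd k) as [[i ->] | [i ->]]; exists i; lia. }
  assert (Heven : forall i, Nat.even (2 * i) = true) by apply Nat.even_even.
  assert (Hodd : forall i, Nat.even (S (2 * i)) = false)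
    by (intros i; rewrite <- Nat.add_1_r; apply Nat.even_odd).
  (* Steps alternately shift [a] and [b], so their exponents are n/2 rounded up and rounded down. *)
  set (X := fun n => rama q (a * q ^ (S n / 2)) (b * q ^ (n / 2)) (lam * q ^ n)).
  assert (X0 : X O = rama q a b lam).
  { unfold X; change (1 / 2)%nat with O; change (0 / 2)%nat with O.
    change (q ^ 0) with (RtoC 1); now rewrite !Cmult_1_r. }
  assert (X1 : X 1%nat = rama q (a * q) b (lam * q)).
  { unfold X; change (2 / 2)%nat with 1%nat; change (1 / 2)%nat with O.
    change (q ^ 0) with (RtoC 1); now rewrite Cpow_1_r, Cmult_1_r. }
  rewrite <- X0, <- X1.
  assert (Hnum0 : forall i, cf_num (F1 a b lam q) (S (2 * i))
                            = a * q ^ i * q + lam * q ^ (2 * i) * q).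
  { intros i; unfold F1, cf_num; rewrite Nat.add_1_r.
    rewrite Hodd, ES, E0, !qpow_S; reflexivity. }
  assert (Hnum1 : forall i, cf_num (F1 a b lam q) (S (S (2 * i)))
                            = b * q ^ i * q + lam * q ^ S (2 * i) * q).
  { intros i; unfold F1, cf_num.
    change (Nat.even (S (S (2 * i)))) with (Nat.even (2 * i)).
    rewrite Heven, ES, E0, !qpow_S; reflexivity. }
  assert (Hrec : forall k, X k = X (S k) + cf_num (F1 a b lam q) (S k) * X (S (S k))).
  { intros k; destruct (Hpar k) as [i [-> | ->]]; unfold X.
    - rewrite Hnum0, !ES, E1, E0, !qpow_S; now apply rama_F1_odd.
    - rewrite Hnum1, !ES, E1, E0, !qpow_S; now apply rama_F1_even. }
  apply (cf_converges_of_solution _ X 1 0).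
  - intros n Hn; destruct n as [| n]; [lia |].
    destruct (Hpar n) as [i [-> | ->]].
    + rewrite Hnum0.
      replace (a * q ^ i * q + lam * q ^ (2 * i) * q)
        with (q ^ S i * (a + lam * q ^ i))
        by (replace (2 * i)%nat with (i + i)%nat by lia;
            rewrite Cpow_add_r, Cpow_S; ring).
      now apply Cmult_neq_0.
    + rewrite Hnum1.
      replace (b * q ^ i * q + lam * q ^ S (2 * i) * q)
        with (q ^ S i * (b + lam * q ^ S i))
        by (replace (2 * i)%nat with (i + i)%nat by lia;
            rewrite !Cpow_S, Cpow_add_r; ring).
      now apply Cmult_neq_0.
  - rewrite (Hrec O) at 1; simpl cf_first; ring.
  - intros k; rewrite (Hrec (S k)) at 1; simpl cf_den; ring.
  - apply (rama_lim_abl q (fun n => a * q ^ (S n / 2)) (fun n => b * q ^ (n / 2))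
             (fun n => lam * q ^ n) Hq).
    + apply (Clim_S (fun n => a * q ^ (n / 2))).
      apply (Clim_half (fun n => a * q ^ n)); now apply Clim_qpow.
    + apply (Clim_half (fun n => b * q ^ n)); now apply Clim_qpow.
    + now apply Clim_qpow.
  - apply C1_nz.
  - assert (Ha := Clim_half _ _ (Clim_qpow q a Hq)).
    apply Clim_S in Ha; apply Clim_0_Cmod in Ha.
    assert (Hb := Clim_0_Cmod _ (Clim_half _ _ (Clim_qpow q b Hq))).
    assert (Hl := Clim_0_Cmod _ (Clim_qpow q lam Hq)).
    apply (Clim_squeeze _ _ (fun k => Cmod (a * q ^ (S k / 2))
             + Cmod (b * q ^ (k / 2)) + Cmod (lam * q ^ k))%R).
    + exists O; intros k _; unfold F1, cf_num; rewrite Nat.add_1_r.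
      assert (H1 := Cmod_ge_0 (a * q ^ (S k / 2))).
      assert (H2 := Cmod_ge_0 (b * q ^ (k / 2))).
      destruct (Nat.even k); unfold Cminus; rewrite Copp_0, Cplus_0_r;
        (eapply Rle_trans; [apply Cmod_triangle | lra]).
    + replace (Finite 0) with (Finite (0 + 0 + 0)%R) by (f_equal; ring).
      repeat apply is_lim_seq_plus'; assumption.
  - rewrite Cmod_0; lra.
Qed.

Lemma F2_converges (a b lam q : C) : (0 < Cmod q < 1)%R ->
  (forall n : nat, (1 <= n)%nat -> lam <> a * b * q ^ n) ->
  cf_converges (F2 a b lam q)
    (ratio (rama q a b lam) (rama q (a * q) b (lam * q))).
Proof.
  intros Hq nz.
  assert (Hqn : forall n, q ^ n <> 0) by (intros n; apply Cpow_nz, Cmod_gt_0; lra).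
  (* From index 1 on, the exponent of [b] lags one behind those of [a] and [lam]; the value at 0
     does not fit this pattern and is given separately. *)
  set (X := fun n => match n with
    | O => rama q a b lam
    | S m => rama q (a * q ^ m * q) (b * q ^ m) (lam * q ^ m * q) end).
  assert (X1 : X 1%nat = rama q (a * q) b (lam * q)).
  { unfold X; change (q ^ 0) with (RtoC 1); now rewrite !Cmult_1_r. }
  rewrite <- X1; change (rama q a b lam) with (X O).
  assert (Hz := fun x => Clim_qpow q x Hq).
  assert (HzS := fun x => Clim_qpow_mult q x Hq).
  apply (cf_converges_of_solution _ X 1 0).
  - intros n Hn; simpl cf_num.
    replace (lam * q ^ n - a * b * q ^ (n + (n + 0)))
      with (q ^ n * (lam - a * b * q ^ n))
      by (rewrite Nat.add_0_r, Cpow_add_r; ring).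
    apply Cmult_neq_0; [apply Hqn |]; intros E; apply (nz n Hn).
    rewrite <- (Cplus_0_r (a * b * q ^ n)), <- E; ring.
  - unfold X, F2, cf_first, cf_num.
    change (2 * 1)%nat with 2%nat; change (q ^ 0) with (RtoC 1).
    replace (q ^ 2) with (q * q) by ring.
    rewrite !Cpow_1_r, !Cmult_1_r; now apply rama_F2_head.
  - intros k; unfold X, F2, cf_den, cf_num.
    rewrite (rama_F2 q (a * q ^ k * q) (b * q ^ k) (lam * q ^ k * q) Hq).
    replace (2 * S (S k))%nat with (S (S (S (S (k + k))))) by lia.
    rewrite Nat.add_1_r, !qpow_S, Cpow_add_r; ring.
  - apply (Clim_S X).
    apply (rama_lim_abl q (fun n => a * q ^ n * q) (fun n => b * q ^ n)
             (fun n => lam * q ^ n * q) Hq); auto.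
  - apply C1_nz.
  - apply (Clim_squeeze _ _
      (fun n => (Cmod lam + Cmod (a * b)) * Cmod q ^ n)%R); [| now apply geom_lim_0].
    exists O; intros n _; unfold F2, cf_num.
    replace (lam * q ^ n - a * b * q ^ (2 * n) - 0)
      with (lam * q ^ n + - (a * b * q ^ n * q ^ n))
      by (replace (2 * n)%nat with (n + n)%nat by lia; rewrite Cpow_add_r; ring).
    eapply Rle_trans; [apply Cmod_triangle |].
    rewrite Cmod_opp, Rmult_plus_distr_r, <- !Cmod_pow, <- !Cmod_mult.
    apply Rplus_le_compat_l; now apply Cmod_qpow_le.
  - rewrite Cmod_0; lra.
Qed.

Lemma Clim_qpow_plus (q c d : C) : (0 < Cmod q < 1)%R ->
  Clim (fun n => c * q ^ n + d) d.
Proof.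
  intros Hq; eapply is_lim_seq_ext; [| exact (Clim_qpow q c Hq)].
  intros n; simpl; f_equal; ring.
Qed.

(** With [b] fixed, the partial numerators tend to [b] and the solution to [qexp q b]. The bound on
    [Cmod b] gives both the contraction and, through [qexp_neq_0], the nonzero limit. *)
Lemma F3_converges (a b lam q : C) : (0 < Cmod q < 1)%R -> (Cmod b < 1)%R ->
  (forall n, b + lam * q ^ S n <> 0) ->
  cf_converges (F3 a b lam q)
    (ratio (rama q a b lam) (rama q (a * q) b (lam * q))).
Proof.
  intros Hq Hb nz_b.
  set (X := fun n => rama q (a * q ^ n) b (lam * q ^ n)).
  assert (X0 : X O = rama q a b lam).
  { unfold X; change (q ^ 0) with (RtoC 1); now rewrite !Cmult_1_r. }
  assert (X1 : X 1%nat = rama q (a * q) b (lam * q)).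
  { unfold X; now rewrite Cpow_1_r. }
  rewrite <- X0, <- X1.
  assert (Hrec : forall k, X k = (1 - b + a * q ^ S k) * X (S k)
                                 + (lam * q ^ S k + b) * X (S (S k))).
  { intros k; unfold X; rewrite !qpow_S; now apply rama_F3. }
  apply (cf_converges_of_solution _ X (qexp q b) b).
  - intros n Hn; destruct n as [| n]; [lia |].
    unfold F3, cf_num; rewrite Cplus_comm; apply nz_b.
  - rewrite (Hrec O) at 1; unfold F3, cf_first, cf_num; now rewrite Cpow_1_r.
  - intros k; rewrite (Hrec (S k)) at 1; unfold F3, cf_den, cf_num.
    now rewrite Nat.add_1_r.
  - apply (rama_lim_al q b (fun n => a * q ^ n) (fun n => lam * q ^ n) Hq);
      now apply Clim_qpow.
  - apply qexp_neq_0; [exact Hq |].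
    rewrite Cmod_mult; assert (H := Cmod_ge_0 b); nra.
  - now apply Clim_qpow_plus.
  - exact Hb.
Qed.

Lemma F4_converges (a b lam q : C) : (0 < Cmod q < 1)%R -> (Cmod (a * q) < 1)%R ->
  (forall n, a + lam * q ^ n <> 0) ->
  cf_converges (F4 a b lam q)
    (ratio (rama q a b lam) (rama q (a * q) b (lam * q))).
Proof.
  intros Hq Ha nz_a.
  assert (Hq0 : q <> 0) by (apply Cmod_gt_0; lra).
  set (X := fun n => match n with
    | O => rama q a b lam
    | S m => rama q (a * q) (b * q ^ m) (lam * q ^ m * q) end).
  assert (X1 : X 1%nat = rama q (a * q) b (lam * q)).
  { unfold X; change (q ^ 0) with (RtoC 1); now rewrite !Cmult_1_r. }
  rewrite <- X1; change (rama q a b lam) with (X O).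
  apply (cf_converges_of_solution _ X (qexp q (a * q)) (a * q)).
  - intros n Hn; destruct n as [| n]; [lia |]; unfold F4, cf_num.
    replace (a * q + lam * q ^ S n) with (q * (a + lam * q ^ n))
      by (rewrite Cpow_S; ring).
    now apply Cmult_neq_0.
  (* The first step shifts [a] and is that of [F1]; all later ones shift [b] and use [rama_F4] with
     [a * q] in place of [a]. *)
  - rewrite X1; unfold X, F4, cf_first, cf_num.
    rewrite !Cpow_1_r, Cmult_1_l; now apply rama_F1_odd.
  - intros k; unfold X, F4, cf_den, cf_num.
    rewrite !qpow_S; now apply rama_F4.
  - apply (Clim_S X).
    apply (rama_lim_bl q (a * q) (fun n => b * q ^ n) (fun n => lam * q ^ n * q) Hq).
    + now apply Clim_qpow.
    + now apply Clim_qpow_mult.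
  - apply qexp_neq_0; [exact Hq |].
    rewrite Cmod_mult; assert (H := Cmod_ge_0 (a * q)); nra.
  - eapply is_lim_seq_ext; [| exact (Clim_qpow_plus q lam (a * q) Hq)].
    intros n; unfold F4, cf_num; now rewrite (Cplus_comm (a * q)).
  - exact Ha.
Qed.

Theorem theorem4p1 (a b lam q : C)
  (hq : (0 < Cmod q < 1)%R)
  (hnz : ~ (a = 0 /\ b = 0 /\ lam = 0))
  (h1 : forall n : nat, (1 <= n)%nat -> lam <> a * b * q ^ n)
  (h2 : forall n : nat, (1 <= n)%nat -> lam <> - b / q ^ n)
  (h3 : forall n : nat, (1 <= n)%nat -> lam <> - a / q ^ (n - 1)) :
  exists f : sphere,
    cf_converges (F1 a b lam q) f /\
    cf_converges (F2 a b lam q) f /\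
    ((Cmod b < 1)%R -> cf_converges (F3 a b lam q) f) /\
    ((Cmod (a * q) < 1)%R -> cf_converges (F4 a b lam q) f).
Proof.
  assert (hqn : forall n, q ^ n <> 0) by (intros n; apply Cpow_nz, Cmod_gt_0; lra).
  assert (nz_b : forall n, b + lam * q ^ S n <> 0).
  { intros n E; apply (h2 (S n)); [lia |].
    replace (- b) with (lam * q ^ S n) by (rewrite <- (Cplus_0_r (- b)), <- E; ring).
    field; apply hqn. }
  (* [h3] at index n + 1 carries the exponent n, so exponent 0 is included here, whereas [nz_b]
     starts at exponent 1. *)
  assert (nz_a : forall n, a + lam * q ^ n <> 0).
  { intros n E; apply (h3 (S n)); [lia |].
    replace (S n - 1)%nat with n by lia.
    replace (- a) with (lam * q ^ n) by (rewrite <- (Cplus_0_r (- a)), <- E; ring).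
    field; apply hqn. }
  (* The common value is G(a,b,lam) / G(aq,b,lam q), read as [Inf] when the denominator vanishes. *)
  exists (ratio (rama q a b lam) (rama q (a * q) b (lam * q))).
  split; [| split; [| split]]; try intros H.
  - now apply F1_converges.
  - now apply F2_converges.
  - now apply F3_converges.
  - now apply F4_converges.
Qed.
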